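(* There is a constant $c>0$ such that the following holds for all sufficiently large $n$: if $f$ is a nice mechanism with prediction for the two-facility game on a line with $n$ agents and its robustness is bounded (finite), then its consistency is at least $c\,n$. That is, the consistency of any such mechanism is $\Omega(n)$.
   Context: Two-facility game on a line with $n$ agents; agent $i$ has location $x_i\in\mathbb{R}$, $\mathbf{x}=(x_1,\dots,x_n)$. For facility locations $\{l_1,l_2\}$, an agent at $y$ has cost $\min\{|l_1-y|,|l_2-y|\}$; the social cost of outputs $\{l_1,l_2\}$ on $\mathbf{x}$ is the sum of the agents' costs, and $OPT(\mathbf{x})$ is the minimum social cost over all choices of $l_1,l_2\in\mathbb{R}$. A (deterministic) mechanism with prediction is a function $f$ that takes a prediction $\widetilde{\mathbf{x}}\in\mathbb{R}^n$ (public, not manipulable) and a reported profile $\mathbf{x}\in\mathbb{R}^n$ and outputs two facility locations $f(\widetilde{\mathbf{x}},\mathbf{x})$. It is a nice mechanism with prediction if, for each fixed prediction $\widetilde{\mathbf{x}}$, the map $\mathbf{x}\mapsto f(\widetilde{\mathbf{x}},\mathbf{x})$ is strategy-proof (no agent $i$ can decrease her cost, measured from her true location $x_i$, by reporting some $x_i'\ne x_i$ while the others' reports are fixed) and has bounded approximation ratio. The consistency of $f$ is the smallest $\gamma$ such that $SC(f(\mathbf{x},\mathbf{x}),\mathbf{x})\le\gamma\,OPT(\mathbf{x})$ for all $\mathbf{x}$ (approximation ratio when the prediction equals the true profile). The robustness of $f$ is the smallest $\lambda$ such that $SC(f(\widetilde{\mathbf{x}},\mathbf{x}),\mathbf{x})\le\lambda\,OPT(\mathbf{x})$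 for all $\widetilde{\mathbf{x}},\mathbf{x}$. *)

(* Defs.v *)
From mathcomp Require Import all_boot all_order all_algebra.
From mathcomp Require Import classical_sets reals.
Set Implicit Arguments. Unset Strict Implicit. Unset Printing Implicit Defensive.
Import Order.TTheory GRing.Theory Num.Theory.
Local Open Scope ring_scope.
Local Open Scope classical_set_scope.

Section TwoFacility.
Variables (R : realType) (n : nat).

Definition profile := 'I_n -> R.
Definition outcome := (R * R)%type.
(* A deterministic mechanism with prediction: f xtilde x. *)
Definition mechanism := profile -> profile -> outcome.

Definition agent_cost (l : outcome) (y : R) : R :=
  Num.min `|l.1 - y| `|l.2 - y|.

Definition SC (l : outcome) (x : profile) : R := \sum_(i < n) agent_cost l (x i).

Definition OPT (x : profile) : R := inf [set SC l x | l in [set: outcome]].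

Definition update (x : profile) (i : 'I_n) (y : R) : profile :=
  fun j => if j == i then y else x j.

Definition strategy_proof (g : profile -> outcome) : Prop :=
  forall (x : profile) (i : 'I_n) (y : R),
    agent_cost (g x) (x i) <= agent_cost (g (update x i y)) (x i).

Definition bounded_approx (g : profile -> outcome) : Prop :=
  exists rho : R, forall x : profile, SC (g x) x <= rho * OPT x.

Definition nice (f : mechanism) : Prop :=
  forall xt : profile, strategy_proof (f xt) /\ bounded_approx (f xt).

Definition consistency_bound (f : mechanism) (gamma : R) : Prop :=
  forall x : profile, SC (f x x) x <= gamma * OPT x.

Definition robustness_bound (f : mechanism) (lambda : R) : Prop :=
  forall xt x : profile, SC (f xt x) x <= lambda * OPT x.

Definition bounded_robustness (f : mechanism) : Prop :=
  exists lambda : R, robustness_bound f lambda.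

(* consistency (the smallest such gamma, +oo if none) is at least a. *)
Definition consistency_at_least (f : mechanism) (a : R) : Prop :=
  forall gamma : R, consistency_bound f gamma -> a <= gamma.

End TwoFacility.

(* Main.v *)
Require Import Defs.
From mathcomp Require Import all_boot all_order all_algebra.
From mathcomp Require Import classical_sets reals.
From mathcomp Require Import boolp zify ring lra.
Import Order.TTheory GRing.Theory Num.Theory.
Local Open Scope ring_scope.

                                                                           
                                                                              
                                                                               
                                                                                
                                                                          
                                 

                                                                          
                                                                       
                                                                             
                                                                            
                                                             
                                                                              
                                                                                
                                                                                
                                               
                                                                       
                                                                           
                                                                    
                                                                        
                                                            
                                                                        
                                                                            
                                                                            
                                      

(** For a fixed prediction, bounded robustness leaves a strategy-proof rule whose largest individual
    cost is within a factor [rho] of optimal on every profile. Put one agent at [-1], one at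
    [L + 1], and about half of the others at each of [0] and [L], with [L = 32 * rho]. Then [OPT] is
    at most 2, while [inner_locations_unserved] says that the groups at [0] and [L] cannot both have
    individual cost below 1. So the social cost is at least the group size [m >= n / 8], already
    when the prediction is this very profile.

    Co-located agents act as one truthful player, which reduces the game to four players [a b c d].
    The engine is the [duel]: two players far from a location [w] cannot have both facilities near
    them, since one facility must stay near [w]. If the left player of a remote close pair is served
    once, this propagates: that player is served whenever left of the other ([dominate]). At a
    failure, the edge of a gap in a player's option set ([right_edge], [left_edge]) would create two
    remote facilities. Both players cannot dominate in this way ([no_min_rule]): no facility could
    ever lie to the right of a pair, yet a very remote player needs one.

    Suppose both inner groups have cost below 1. Then the player at [L] dominates to the right and,
    by reflection, the player at [0] dominates to the left. The two outer players are carried to one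
    far left point [- A]; [irrelevant_move] and [dominate3_left] preserve service of the inner
    player concerned. Seen from [- A], each inner player is now served in some close pair as the
    left one, which [no_min_rule3] forbids. *)

Set Implicit Arguments.
Unset Strict Implicit.
Unset Printing Implicit Defensive.

(** * Option sets of one truthful player *)

Section Outcomes.
Variable R : realType.
Implicit Types (l : outcome R) (b p q s t v x y z : R).

Definition serves l v := l.1 = v \/ l.2 = v.

Definition mirror s l : outcome R := (s - l.1, s - l.2).

Lemma cost_le l v b :
  agent_cost l v <= b <->
  (v - b <= l.1 /\ l.1 <= v + b) \/ (v - b <= l.2 /\ l.2 <= v + b).
Proof.
rewrite /agent_cost ge_min !ler_distl; split.
  by case/orP => /andP[? ?]; [left|right].
by case=> -[-> ->]; rewrite ?orbT.
Qed.

Lemma cost_ge0 l v : 0 <= agent_cost l v.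
Proof. by rewrite /agent_cost le_min !normr_ge0. Qed.

Lemma cost_mirror s l v :
  agent_cost (mirror s l) v = agent_cost l (s - v).
Proof.
rewrite /agent_cost /mirror /=.
by congr (Num.min _ _); rewrite -normrN; congr `|_|; ring.
Qed.

Lemma serves_cost l v : serves l v <-> agent_cost l v <= 0.
Proof.
rewrite cost_le /serves; split.
  by case=> ->; [left|right]; split; lra.
by case=> -[? ?]; [left|right]; lra.
Qed.

Lemma serves_mirror s l v : serves (mirror s l) v <-> serves l (s - v).
Proof. by rewrite !serves_cost cost_mirror. Qed.

Lemma serves_costW l p v b : serves l p -> v - b <= p -> p <= v + b ->
  agent_cost l v <= b.
Proof. by case=> <- ? ?; rewrite cost_le; [left|right]. Qed.

Lemma cost_serves l v b : agent_cost l v <= b ->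
  exists p, [/\ serves l p, v - b <= p & p <= v + b].
Proof.
by rewrite cost_le => -[[? ?]|[? ?]]; [exists l.1|exists l.2]; split => //;
  [left|right].
Qed.

Lemma serves2_cost_ge l p q v b : serves l p -> serves l q -> p < q ->
  v + b <= p -> b <= agent_cost l v.
Proof.
move=> lp lq pq vp; rewrite leNgt; apply/negP => hb.
have /cost_serves[r [lr r1 r2]] := lexx (agent_cost l v).
by case: lp lq lr => ? [?|?] [?|?]; lra.
Qed.

Definition truthful (phi : R -> outcome R) :=
  forall x y, agent_cost (phi x) x <= agent_cost (phi y) x.

(** Every position reachable by some report is in the option set, and a player standing there
    obtains it by telling the truth. *)
Lemma truthful_serves phi x y : truthful phi -> serves (phi y) x ->
  serves (phi x) x.
Proof. by rewrite !serves_cost => tphi; apply: le_trans. Qed.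

Lemma truthful_cost phi x y p b : truthful phi -> serves (phi y) p ->
  x - b <= p -> p <= x + b -> agent_cost (phi x) x <= b.
Proof.
by move=> tphi yp p1 p2; apply: le_trans (tphi x y) _; apply: serves_costW yp p1 p2.
Qed.

Lemma truthful_mirror s phi :
  truthful phi -> truthful (fun x => mirror s (phi (s - x))).
Proof. by move=> tphi x y; rewrite !cost_mirror. Qed.

(** The unserved point [x] lies in a gap of the option set, which is closed by truthfulness; [q] is
    the right end of the gap. A player in the gap just below [q] has no nearer option, so the
    outcome must serve [q]. *)
Lemma right_edge phi x t y : truthful phi -> ~ serves (phi x) x ->
  x < t -> serves (phi y) t ->
  exists q, [/\ x < q, q <= t & forall eta : R, 0 < eta ->
    exists z, [/\ x < z, z < q, q - z < eta & serves (phi z) q]].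
Proof.
move=> tphi xun xt yt.
pose E := [set s | [/\ x <= s, s <= t & serves (phi s) s]]%classic.
have Et : E t by split; [exact: ltW|exact: lexx|exact: truthful_serves yt].
have lbE : has_lbound E by exists x => s [].
have infE : has_inf E by split; [exists t|].
pose q := inf E.
have qlb s : E s -> q <= s by move=> Es; apply: ge_inf.
have xq : x <= q by apply: lb_le_inf; [exists t|move=> s []].
have qt : q <= t by exact: qlb.
have qz : serves (phi q) q.
  apply/serves_cost; rewrite leNgt; apply/negP => c0.
  have [s [xs st ss]] := inf_adherent c0 infE.
  rewrite -/q => sq; have qs : q <= s by apply: qlb.
  suff : agent_cost (phi q) q <= s - q by lra.
  by apply: (truthful_cost tphi ss); lra.
have xq' : x < q.
  by rewrite lt_neqAle xq andbT; apply/eqP => xqE; apply: xun; rewrite xqE.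
exists q; split => // eta eta0.
(* The bound [(q - x) / 4] keeps the interval from [q - 2 * d] to [q] to the right of [x], so an
   option found there lies in [E], hence equals [q]. *)
pose d := Num.min (eta / 2) ((q - x) / 4).
have [d1 d2] : d <= eta / 2 /\ d <= (q - x) / 4.
  by rewrite /d; split; rewrite ge_min lexx ?orbT.
have d0 : 0 < d by rewrite /d lt_min; apply/andP; split; lra.
exists (q - d); split; try lra.
have [p [pz p1 p2]] : exists p, [/\ serves (phi (q - d)) p, q - d - d <= p
    & p <= q - d + d].
  by apply: cost_serves; apply: (truthful_cost tphi qz); lra.
have Ep : E p by split; [lra|lra|exact: truthful_serves pz].
have pq : p = q by have qp := qlb _ Ep; apply/le_anti/andP; split; lra.
by rewrite pq in pz.
Qed.

Lemma left_edge phi x t y : truthful phi -> ~ serves (phi x) x ->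
  t < x -> serves (phi y) t ->
  exists q, [/\ t <= q, q < x & forall eta : R, 0 < eta ->
    exists z, [/\ q < z, z < x, z - q < eta & serves (phi z) q]].
Proof.
move=> tphi xun tx yt.
have oppK0 (v : R) : 0 - (0 - v) = v by ring.
have [] := @right_edge _ (0 - x) (0 - t) (0 - y) (truthful_mirror 0 tphi).
- by rewrite serves_mirror !oppK0.
- lra.
- by rewrite serves_mirror !oppK0.
move=> q [q1 q2 qe]; exists (0 - q); split; [lra|lra|] => eta eta0.
have [z [z1 z2 z3]] := qe _ eta0.
by rewrite serves_mirror => zz; exists (0 - z); split; [lra|lra|lra|].
Qed.

End Outcomes.

(** * Two truthful players remote from a location [w] *)

Section Duel.
Variable R : realType.
Implicit Types (a b p q t u v x y z : R).
Variables (rho e w M : R) (g : R -> R -> outcome R).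

                                                                         
                                                                                  
(** The remaining players are frozen around [w] within radius [e]; both duellists stay beyond [M],
    so far away that [e] is negligible. *)
Record duel : Prop := Duel {
  duel_rho1 : 1 <= rho;
  duel_wM : w < M;
  duel_far : 8 * (rho * e) <= M - w;
  duel_truthful1 : forall y, truthful (g ^~ y);
  duel_truthful2 : forall x, truthful (g x);
  duel_diag : forall z, M <= z -> serves (g z z) z;
  duel_remote : forall x y b, M <= x -> M <= y -> x - y <= b -> y - x <= b ->
    agent_cost (g x y) w <= rho * (e + b)
}.

Hypothesis dg : duel.

(** There are only two facilities: if they are [p < q], then [w] pays at least [p - w], which
    [duel_remote] bounds. *)
Lemma duel_two x y p q b : M <= x -> M <= y -> x - y <= b -> y - x <= b ->
  serves (g x y) p -> serves (g x y) q -> p < q ->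
  p - w <= rho * (e + b).
Proof.
move=> Mx My xy yx gp gq pq.
apply: le_trans (duel_remote dg Mx My xy yx).
by apply: (serves2_cost_ge gp gq pq); lra.
Qed.

Lemma rho_mono a b : a <= b -> rho * a <= rho * b.
Proof. by have := duel_rho1 dg; move=> r1 ab; apply: ler_wpM2l => //; lra. Qed.

(** The gap is small relative to the distance from [w], so by [duel_two] a facility around [u]
    excludes another one to its right. The factor 8 leaves slack for [e] and for doubled gaps. *)
Definition close u y := 8 * (rho * (y - u)) <= u - w.

Lemma closeW u y v x : close u y -> x - v <= y - u -> u <= v -> close v x.
Proof. by rewrite /close => uy /rho_mono xv uv; lra. Qed.

Lemma seed_left u z x : M <= u -> close u z -> serves (g u z) u ->
  u <= x -> x <= z -> serves (g x z) x.
Proof.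
have far := duel_far dg; have wM := duel_wM dg.
move=> Mu uz su ux xz; apply: contrapT => xun.
have ux' : u < x.
  by rewrite lt_neqAle ux andbT; apply/eqP => xE; apply: xun; rewrite -xE.
have [p [up px /(_ _ ltr01)[y [py yx _ sp]]]] :=
  left_edge (duel_truthful1 dg z) xun ux' su.
have yz : y < z by lra.
have syy : serves (g y y) y by apply: (duel_diag dg); lra.
(* By reporting [y] the second player would get [y] itself, so she has a facility at or right of
   [y], besides the one at [p]. *)
have [q [sq q1 q2]] : exists q, [/\ serves (g y z) q, z - (z - y) <= q
    & q <= z + (z - y)].
  by apply: cost_serves; apply: (truthful_cost (duel_truthful2 dg y) syy); lra.
have pq : p < q by lra.
have : p - w <= rho * (e + (z - y)).
  by apply: (duel_two _ _ _ _ sp sq pq); lra.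
have : rho * (z - y) <= rho * (z - u) by apply: rho_mono; lra.
rewrite /close in uz; lra.
Qed.

Lemma seed_right u z y : M <= u -> u < z -> close u z -> serves (g u z) u ->
  u < y -> close u y -> serves (g u y) u.
Proof.
have [[r1 far] wM] := (duel_rho1 dg, duel_far dg, duel_wM dg).
move=> Mu uz cuz su uy cuy; apply: contrapT => yun.
have cost_y : agent_cost (g u y) y <= y - u.
  by have := truthful_cost (duel_truthful2 dg u) su; apply; lra.
have [t [st t1 t2]] := cost_serves cost_y.
have ut : u < t.
  have ut' : u <= t by lra.
  rewrite lt_neqAle ut' andbT.
  by apply/eqP => utE; apply: yun; rewrite [X in serves _ X]utE.
rewrite /close in cuz cuy.
have no_two p v b : u <= v -> v - u <= b -> serves (g u v) p -> forall q,
    serves (g u v) q -> p < q -> p - w <= rho * (e + b).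
  move=> uv vb sp q sq pq; apply: (duel_two _ _ _ _ sp sq pq); lra.
have zun : ~ serves (g u z) z.
  move=> sz; have := no_two u z (z - u); move=> /(_ _ _ su z sz uz); lra.
have zt : z < t.
  rewrite ltNge; apply/negP => tz.
  have stt := truthful_serves (duel_truthful2 dg u) st.
  have [q [sq q1 q2]] : exists q, [/\ serves (g u z) q, z - (z - t) <= q
      & q <= z + (z - t)].
    by apply: cost_serves; apply: (truthful_cost (duel_truthful2 dg u) stt); lra.
  have := no_two u z (z - u); move=> /(_ _ _ su q sq); lra.
have [q [zq qt /(_ _ ltr01)[v [zv vq _ sq]]]] :=
  right_edge (duel_truthful2 dg u) zun zt st.
have svv : serves (g v v) v by apply: (duel_diag dg); lra.
(* The first player could join the other at [v], so a second facility [p] lies left of [q] and still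
   far from [w]. *)
have [p [sp p1 p2]] : exists p, [/\ serves (g u v) p, u - (v - u) <= p
    & p <= u + (v - u)].
  by apply: cost_serves; apply: (truthful_cost (duel_truthful1 dg v) svv); lra.
have pq : p < q by lra.
have := no_two p v (v - u); move=> /(_ _ _ sp q sq pq).
have : rho * (v - u) <= rho * (2 * (y - u)) by apply: rho_mono; lra.
have : 1 * (y - u) <= rho * (y - u) by apply: ler_wpM2r; lra.
lra.
Qed.

Definition seeded u := exists z, [/\ u < z, close u z & serves (g u z) u].

Lemma seeded_close u x : M <= u -> seeded u -> u <= x ->
  8 * (rho * (x - u)) < u - w -> seeded x.
Proof.
have [[r1 far] wM] := (duel_rho1 dg, duel_far dg, duel_wM dg).
move=> Mu [z0 [uz0 cz0 su]] ux xu.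
(* The farthest point close to [u]: the partner is moved there, then [u] slides up to [x]. *)
pose z := u + (u - w) / (8 * rho).
have rho_z : 8 * (rho * (z - u)) = u - w by rewrite /z; field; lra.
have xz : x < z.
  rewrite ltNge; apply/negP => zx.
  have : rho * (z - u) <= rho * (x - u) by apply: rho_mono; lra.
  lra.
have cz : close u z by rewrite /close rho_z lexx.
exists z; split=> //; first by apply: (closeW cz _ ux); lra.
apply: (seed_left Mu cz _ ux (ltW xz)).
by apply: (seed_right Mu uz0 cz0 su _ cz); apply: le_lt_trans xz.
Qed.

Lemma seeded_up u x : M <= u -> seeded u -> u <= x -> seeded x.
Proof.
have [[r1 far] wM] := (duel_rho1 dg, duel_far dg, duel_wM dg).
move=> Mu su ux.
(* Half of the reach that [seeded_close] guarantees everywhere beyond [M], so a uniform step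
   suffices. *)
pose s := (M - w) / (16 * rho).
have s0 : 0 < s by rewrite /s; apply: divr_gt0; lra.
have rho_s : 16 * (rho * s) = M - w by rewrite /s; field; lra.
have step (k : nat) : forall y, u <= y -> y <= u + k%:R * s -> seeded y.
  elim: k => [|k IHk] y uy yu.
    by have -> : y = u by apply/le_anti/andP; split; lra.
  rewrite -natr1 in yu.
  have [yk|ky] := leP y (u + k%:R * s); first exact: IHk.
  have ks0 : 0 <= k%:R * s by apply: mulr_ge0; [exact: ler0n|lra].
  apply: (seeded_close (u := u + k%:R * s)); [lra|apply: IHk; lra|lra|].
  have : rho * (y - (u + k%:R * s)) <= rho * s by apply: rho_mono; lra.
  lra.
have d0 : 0 <= (x - u) / s by apply: divr_ge0; lra.
apply: (step (Num.bound ((x - u) / s))) => //.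
have := archi_boundP d0; rewrite ltr_pdivrMr //; lra.
Qed.

Lemma seeded_serves u y : M <= u -> seeded u -> u < y -> close u y ->
  serves (g u y) u.
Proof. by move=> Mu [z [uz cuz su]] uy cuy; apply: seed_right cuz su _ _. Qed.

Lemma diag_close x y : M <= x -> y - x <= (M - w) / (8 * rho) -> close x y.
Proof.
have [[r1 far] wM] := (duel_rho1 dg, duel_far dg, duel_wM dg).
move=> Mx /rho_mono; have -> : rho * ((M - w) / (8 * rho)) = (M - w) / 8.
  by field; lra.
rewrite /close; lra.
Qed.

Let scale_gt0 : 0 < (M - w) / (8 * rho).
Proof.
have [[r1 far] wM] := (duel_rho1 dg, duel_far dg, duel_wM dg).
by apply: divr_gt0; lra.
Qed.

(** Closeness of [x] and [y] is not assumed: at the right edge [q] of a gap, the second player can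
    be brought to [q] as well, giving a close pair [v], [q] with both ends served. *)
Lemma dominate u x y : M <= u -> seeded u -> u <= x -> x <= y ->
  serves (g x y) x.
Proof.
have [[r1 far] wM] := (duel_rho1 dg, duel_far dg, duel_wM dg).
move=> Mu su ux xy; apply: contrapT => xun.
have syy : serves (g y y) y by apply: (duel_diag dg); lra.
have xy' : x < y.
  rewrite lt_neqAle xy andbT; apply/eqP => xyE.
  by apply: xun; move: syy; rewrite -xyE.
have [q [xq qy /(_ _ scale_gt0)[v [xv vq qv sq]]]] :=
  right_edge (duel_truthful1 dg y) xun xy' syy.
have Mv : M <= v by lra.
have cvq : close v q by apply: diag_close => //; apply: ltW.
have sq' := truthful_serves (duel_truthful2 dg v) sq.
have sv : serves (g v q) v.
  by apply: seeded_serves => //; apply: (seeded_up Mu su); lra.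
have : v - w <= rho * (e + (q - v)).
  by apply: (duel_two _ _ _ _ sv sq' vq); lra.
rewrite /close in cvq; lra.
Qed.

End Duel.

(** * The two duellists cannot both dominate *)

Section MinRule.
Variable R : realType.
Variables (rho e w M : R) (g : R -> R -> outcome R).
Implicit Types (t u v y z : R).

Lemma duel_swap : duel rho e w M g -> duel rho e w M (fun x y => g y x).
Proof.
case=> r1 wM far t1 t2 gd gr; split=> // x y b Mx My xy yx.
exact: gr.
Qed.

Hypothesis dg : duel rho e w M g.

(** A reachable [t > v] would put a gap edge [q] right of [v], with [g v a] serving [q] for some [a]
    just below. Moving the first player to [q] keeps [q] served, while the second player's dominance
    serves [a] too. *)
Lemma no_min_rule u u' t v : M <= u -> M <= u' ->
  seeded rho w g u -> seeded rho w (fun x y => g y x) u' ->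
  u <= v -> u' <= v ->
  v < t -> forall y, serves (g v y) t -> False.
Proof.
have [[r1 far] wM] := (duel_rho1 dg, duel_far dg, duel_wM dg).
move=> Mu Mu' su su' uv u'v vt y st.
pose d := (M - w) / (8 * rho).
have d0 : 0 < d by apply: divr_gt0; lra.
have near (a b : R) : v <= a -> a < b -> b - a <= d ->
    forall l, serves l a -> serves l b -> l = g a b \/ l = g b a -> False.
  move=> va ab ad l la lb.
  have : close rho w a b by apply: (diag_close dg) => //; lra.
  rewrite /close => cab lE.
  have : a - w <= rho * (e + (b - a)).
    by case: lE => lE; rewrite lE in la lb; apply: (duel_two dg _ _ _ _ la lb ab);
       lra.
  lra.
pose z := Num.min (v + d) ((v + t) / 2).
have [zd zt] : z <= v + d /\ z <= (v + t) / 2.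
  by rewrite /z; split; rewrite ge_min lexx ?orbT.
have vz : v < z by rewrite /z lt_min; apply/andP; split; lra.
have zun : ~ serves (g v z) z.
  move=> sz; apply: (near v z) sz _; [lra|lra|lra| |by left].
  by apply: (dominate dg Mu su); lra.
have zt' : z < t by lra.
have [q [zq qt /(_ _ d0)[a [za aq qa sq]]]] :=
  right_edge (duel_truthful2 dg v) zun zt' st.
have sq' := truthful_serves (duel_truthful1 dg a) sq.
have sa : serves (g q a) a.
  by apply: (dominate (duel_swap dg) Mu' su'); lra.
by apply: (near a q) sa sq' _; [lra|lra|lra|right].
Qed.

End MinRule.

(** * Three players, approximation in maximum cost *)

Section ThreePlayers.
Variable R : realType.
Implicit Types (l : outcome R) (a b p q r s t u v w x y z : R).
Implicit Types h : R -> R -> R -> outcome R.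

Definition covers l b (s : seq R) := all (fun v => agent_cost l v <= b) s.

                                                                          
                                  
Record game3 (rho : R) h : Prop := Game3 {
  game3_rho1 : 1 <= rho;
  game3_truthful1 : forall y z, truthful (fun x => h x y z);
  game3_truthful2 : forall x z, truthful (fun y => h x y z);
  game3_truthful3 : forall x y, truthful (fun z => h x y z);
  game3_approx : forall x y z l b, covers l b [:: x; y; z] ->
    covers (h x y z) (rho * b) [:: x; y; z]
}.

Variable rho : R.

Lemma game3_swap12 h : game3 rho h -> game3 rho (fun x y z => h y x z).
Proof.
case=> r1 t1 t2 t3 ap; split=> // x y z l b.
move=> /and4P[cx cy cz _]; have := ap y x z l b.
by rewrite /covers /= cx cy cz => /(_ isT)/and4P[-> -> -> _].
Qed.

Lemma game3_swap23 h : game3 rho h -> game3 rho (fun x y z => h x z y).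
Proof.
case=> r1 t1 t2 t3 ap; split=> // x y z l b.
move=> /and4P[cx cy cz _]; have := ap x z y l b.
by rewrite /covers /= cx cy cz => /(_ isT)/and4P[-> -> -> _].
Qed.

Lemma game3_mirror s h : game3 rho h ->
  game3 rho (fun x y z => mirror s (h (s - x) (s - y) (s - z))).
Proof.
case=> r1 t1 t2 t3 ap; split=> //.
- by move=> y z; exact: (truthful_mirror s (t1 (s - y) (s - z))).
- by move=> x z; exact: (truthful_mirror s (t2 (s - x) (s - z))).
- by move=> x y; exact: (truthful_mirror s (t3 (s - x) (s - y))).
move=> x y z l b cl; rewrite /covers /= !cost_mirror.
apply: (ap _ _ _ (mirror s l)); rewrite /= !cost_mirror.
by have sK v : s - (s - v) = v by [ring]; rewrite !sK.
Qed.

Lemma covers_pair3 p q b x y z : 0 <= b ->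
  (forall v, v \in [:: x; y; z] -> v = p \/ (q - b <= v /\ v <= q + b)) ->
  covers (p, q) b [:: x; y; z].
Proof.
move=> b0 pq; apply/allP => v /pq[->|[? ?]]; rewrite cost_le /=.
  by left; lra.
by right; lra.
Qed.

Lemma game3_cost h x y z p q b v : game3 rho h -> 0 <= b ->
  (forall v, v \in [:: x; y; z] -> v = p \/ (q - b <= v /\ v <= q + b)) ->
  v \in [:: x; y; z] -> agent_cost (h x y z) v <= rho * b.
Proof.
move=> gh b0 /(covers_pair3 b0)/(game3_approx gh)/allP; exact.
Qed.

Lemma duel_game3 h w M : game3 rho h -> w < M -> duel rho 0 w M (h w).
Proof.
move=> gh wM; have [r1 t1 t2 t3 ap] := gh; split=> //.
- by rewrite !mulr0; lra.
- move=> z _; rewrite serves_cost -(mulr0 rho).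
  apply: (game3_cost (p := w) (q := z) gh); rewrite ?inE ?eqxx ?orbT //.
  by move=> v; rewrite !inE => /or3P[] /eqP->; [left|right|right]; lra.
move=> x y b Mx My xy yx; rewrite add0r.
apply: (game3_cost (p := w) (q := x) gh); rewrite ?inE ?eqxx ?orbT //.
  by lra.
by move=> v; rewrite !inE => /or3P[] /eqP->; [left|right|right]; lra.
Qed.

Lemma dominate3 h w u z x y : game3 rho h -> w < u -> u < z ->
  8 * (rho * (z - u)) <= u - w -> serves (h w u z) u ->
  u <= x -> x <= y -> serves (h w x y) x.
Proof.
move=> gh wu uz cz su; apply: (dominate (duel_game3 gh wu) (lexx u)).
by exists z.
Qed.

Lemma no_min_rule3 h w u z u' z' : game3 rho h ->
  w < u -> u < z -> 8 * (rho * (z - u)) <= u - w -> serves (h w u z) u ->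
  w < u' -> u' < z' -> 8 * (rho * (z' - u')) <= u' - w ->
  serves (h w z' u') u' -> False.
Proof.
move=> gh wu uz cz su wu' uz' cz' su'.
have r1 := game3_rho1 gh.
pose M := Num.min u u'; pose v := Num.max u u'.
have wM : w < M by rewrite /M lt_min wu.
have [uv u'v] : u <= v /\ u' <= v.
  by rewrite /v; split; rewrite le_max lexx ?orbT.
have [Mu Mu'] : M <= u /\ M <= u'.
  by rewrite /M; split; rewrite ge_min lexx ?orbT.
(* Far enough that the approximation bound forces a facility at or beyond [v + 1]. *)
pose y := v + rho * (v - w) + 1.
have vw : 0 <= rho * (v - w) by apply: mulr_ge0; lra.
have /cost_serves[t [st t1 _]] : agent_cost (h w v y) y <= rho * (v - w).
  apply: (game3_cost (p := y) (q := v) gh); rewrite ?inE ?eqxx ?orbT //.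
    by lra.
  by move=> a; rewrite !inE => /or3P[] /eqP->; [right|right|left]; lra.
apply: (no_min_rule (duel_game3 gh wM) Mu Mu' _ _ uv u'v _ st).
- by exists z.
- by exists z'.
by rewrite /y in t1; lra.
Qed.

Lemma sub0K v : 0 - (0 - v) = v. Proof. by ring. Qed.

Lemma dominate3_left h w u z x y : game3 rho h -> u < w -> z < u ->
  8 * (rho * (u - z)) <= w - u -> serves (h w u z) u ->
  x <= u -> y <= x -> serves (h w x y) x.
Proof.
move=> gh uw zu cz su xu yx.
have := @dominate3 _ (0 - w) (0 - u) (0 - z) (0 - x) (0 - y)
  (game3_mirror 0 gh).
by rewrite !serves_mirror !sub0K; apply=> //; lra.
Qed.

Lemma no_max_rule3 h w u z u' z' : game3 rho h ->
  u < w -> z < u -> 8 * (rho * (u - z)) <= w - u -> serves (h w u z) u ->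
  u' < w -> z' < u' -> 8 * (rho * (u' - z')) <= w - u' ->
  serves (h w z' u') u' -> False.
Proof.
move=> gh uw zu cz su uw' zu' cz' su'.
have := @no_min_rule3 _ (0 - w) (0 - u) (0 - z) (0 - u') (0 - z')
  (game3_mirror 0 gh).
by rewrite !serves_mirror !sub0K; apply=> //; lra.
Qed.

(** If [z] were in a gap, its left edge [p] would be served with the third player just right of [p].
    Either of the other players can then be moved onto [p], which gives both of them a max rule as
    seen from a point [Y] far to the right. *)
Lemma remote_served h a b z : game3 rho h -> a < b ->
  4 * (rho * (b - a)) < z - b -> serves (h a b z) z.
Proof.
move=> gh ab bz; have r1 := game3_rho1 gh.
have ba0 : 0 < rho * (b - a) by apply: mulr_gt0; lra.
apply: contrapT => zun.
(* A report here yields an option within [rho * (b - a)] of it, hence strictly between [b] and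
   [z]. *)
pose z0 := z - 2 * (rho * (b - a)).
have /cost_serves[t [st t1 t2]] : agent_cost (h a b z0) z0 <= rho * (b - a).
  apply: (game3_cost (p := z0) (q := b) gh); rewrite ?inE ?eqxx ?orbT //.
    by lra.
  by move=> v; rewrite !inE => /or3P[] /eqP->; [right|right|left]; lra.
have tz : t < z by rewrite /z0 in t2; lra.
have bt : b < t by rewrite /z0 in t1; lra.
have eta0 : 0 < (t - b) / (8 * rho) by apply: divr_gt0; lra.
have [p [tp pz /(_ _ eta0)[y [py _ yp sp]]]] :=
  left_edge (game3_truthful3 gh a b) zun tz st.
have cy : 8 * (rho * (y - p)) <= t - b.
  have : rho * (y - p) <= rho * ((t - b) / (8 * rho)).
    by apply: ler_wpM2l; lra.
  have -> : rho * ((t - b) / (8 * rho)) = (t - b) / 8 by field; lra.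
  lra.
have spa := truthful_serves (game3_truthful1 gh b y) sp.
have spb := truthful_serves (game3_truthful2 gh a y) sp.
pose Y := p + 8 * (rho * (p - a)) + y - a.
have pa0 : 0 < rho * (p - a) by apply: mulr_gt0; lra.
have pba : rho * (p - b) <= rho * (p - a) by apply: ler_wpM2l; lra.
have pY : p <= Y by rewrite /Y; lra.
have spaY : serves (h p b Y) p.
  by apply: (dominate3 (game3_swap12 gh) _ py _ spa (lexx p) pY); lra.
have spbY : serves (h a p Y) p.
  by apply: (dominate3 gh _ py _ spb (lexx p) pY); lra.
have gh' : game3 rho (fun w x y => h x y w).
  by exact: game3_swap12 (game3_swap23 gh).
by apply: (no_max_rule3 (u := p) (u' := p) (z := b) (z' := a) (w := Y) gh' _ _ _
  spaY _ _ _ spbY); rewrite /Y; lra.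
Qed.

(** At report [y] the facilities are [p] and one left of [p], so the mover pays [y - p] and has no
    option strictly between [p] and [2 * y - p]. Hence no new facility lies in that range, which
    contains [q], and missing [p] would leave both facilities far from [r]. The mover is a separate
    player described by [phi], so a fourth player can join [r]. *)
Lemma irrelevant_move h (phi : R -> outcome R) r p q y y' : game3 rho h ->
  truthful phi -> phi y' = h r p q ->
  r < p -> p < q -> p < y -> q < 2 * y - p ->
  8 * (rho * (q - p)) <= p - r ->
  serves (phi y) p -> agent_cost (phi y) r < p - r -> serves (h r p q) p.
Proof.
move=> gh tphi phiE rp pq py qy cl sp cr; have r1 := game3_rho1 gh.
have hole v : serves (h r p q) v -> p < v -> q < v.
  move=> sv pv; rewrite ltNge; apply/negP => vq.
  have : agent_cost (phi y) y < y - p.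
    apply: le_lt_trans (tphi y y') _; rewrite phiE.
    pose b := Num.max (v - y) (y - v).
    have [b1 b2] : v - y <= b /\ y - v <= b.
      by rewrite /b; split; rewrite le_max lexx ?orbT.
    have : b < y - p by rewrite gt_max; apply/andP; split; lra.
    by apply: le_lt_trans; apply: (serves_costW sv); lra.
  move=> cy; have [s [ss s1 s2]] := cost_serves (lexx (agent_cost (phi y) y)).
  have := serves2_cost_ge (v := r) (b := p - r) sp ss; lra.
have sp2 (x : R) : serves (h r x x) x.
  by rewrite serves_cost -(mulr0 rho);
   apply: (game3_cost (p := r) (q := x) gh); rewrite ?inE ?eqxx ?orbT //;
   move=> v; rewrite !inE => /or3P[] /eqP->; [left|right|right]; lra.
have [t [st t1 t2]] : exists t, [/\ serves (h r p q) t, q - (q - p) <= t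
    & t <= q + (q - p)].
  by apply: cost_serves; apply: (truthful_cost (game3_truthful3 gh r p) (sp2 p));
    lra.
have [s [ss s1 s2]] : exists s, [/\ serves (h r p q) s, p - (q - p) <= s
    & s <= p + (q - p)].
  by apply: cost_serves; apply: (truthful_cost (game3_truthful2 gh r q) (sp2 q));
    lra.
apply: contrapT => pun.
have tNp : t <> p by move=> tE; apply: pun; rewrite -[X in serves _ X]tE.
have sNp : s <> p by move=> sE; apply: pun; rewrite -[X in serves _ X]sE.
have st' : s < t.
  have := hole t st; have := hole s ss.
  by move/eqP: tNp; move/eqP: sNp; rewrite !neq_lt => /orP[] ? /orP[] ?; lra.
have : agent_cost (h r p q) r <= rho * (q - p).
  apply: (game3_cost (p := r) (q := p) gh); rewrite ?inE ?eqxx ?orbT //.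
    by lra.
  by move=> v; rewrite !inE => /or3P[] /eqP->; [left|right|right]; lra.
have := serves2_cost_ge (v := r) (b := p - (q - p) - r) ss st st'.
have : 1 * (q - p) <= rho * (q - p) by apply: ler_wpM2r; lra.
lra.
Qed.

Lemma irrelevant_move_left h (phi : R -> outcome R) r p q y y' : game3 rho h ->
  truthful phi -> phi y' = h r p q ->
  p < r -> q < p -> y < p -> 2 * y - p < q ->
  8 * (rho * (p - q)) <= r - p ->
  serves (phi y) p -> agent_cost (phi y) r < r - p -> serves (h r p q) p.
Proof.
move=> gh tphi phiE pr qp yp qy cl sp cr.
have := @irrelevant_move _ _ (0 - r) (0 - p) (0 - q) (0 - y) (0 - y')
  (game3_mirror 0 gh) (truthful_mirror 0 tphi).
by rewrite !serves_mirror !cost_mirror !sub0K phiE; apply=> //; lra.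
Qed.

End ThreePlayers.

(** * Four players and their mergers into three *)

Section FourPlayers.
Variable R : realType.
Implicit Types (l : outcome R) (a b c d p q r s t u v w x y z : R).
Implicit Types k : R -> R -> R -> R -> outcome R.

Record game4 (rho : R) k : Prop := Game4 {
  game4_rho1 : 1 <= rho;
  game4_truthful1 : forall b c d, truthful (fun a => k a b c d);
  game4_truthful2 : forall a c d, truthful (fun b => k a b c d);
  game4_truthful3 : forall a b d, truthful (fun c => k a b c d);
  game4_truthful4 : forall a b c, truthful (k a b c);
  game4_approx : forall a b c d l e, covers l e [:: a; b; c; d] ->
    covers (k a b c d) (rho * e) [:: a; b; c; d]
}.

Variables (rho L : R) (k : R -> R -> R -> R -> outcome R).
Hypothesis gk : game4 rho k.

Lemma game4_mirror s :
  game4 rho (fun a b c d => mirror s (k (s - d) (s - c) (s - b) (s - a))).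
Proof.
case: gk => r1 t1 t2 t3 t4 ap; split=> //.
- by move=> b c d; exact: (truthful_mirror s (t4 (s - d) (s - c) (s - b))).
- by move=> a c d; exact: (truthful_mirror s (t3 (s - d) (s - c) (s - a))).
- by move=> a b d; exact: (truthful_mirror s (t2 (s - d) (s - b) (s - a))).
- by move=> a b c; exact: (truthful_mirror s (t1 (s - c) (s - b) (s - a))).
move=> a b c d l e; rewrite /covers /= !cost_mirror => /and5P[ca cb cc cd _].
have sK v : s - (s - v) = v by ring.
have := ap (s - d) (s - c) (s - b) (s - a) (mirror s l) e.
rewrite /covers /= !cost_mirror !sK ca cb cc cd.
by move=> /(_ isT)/and5P[-> -> -> -> _].
Qed.

Lemma truthful_merge (phi : R -> R -> outcome R) :
  (forall y, truthful (phi ^~ y)) -> (forall x, truthful (phi x)) ->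
  truthful (fun x => phi x x).
Proof. by move=> t1 t2 x y; exact: le_trans (t1 x x y) (t2 y x y). Qed.

Lemma game4_merge34 : game3 rho (fun a b c => k a b c c).
Proof.
case: gk => r1 t1 t2 t3 t4 ap; split=> //.
- by move=> a b; exact: (truthful_merge (t3 a b) (t4 a b)).
move=> a b c l e; rewrite /covers /= => /and4P[ca cb cc _].
have := ap a b c c l e; rewrite /covers /= ca cb cc.
by move=> /(_ isT)/and5P[-> -> -> _ _].
Qed.

Lemma game4_merge24 : game3 rho (fun w x y => k y w x w).
Proof.
case: gk => r1 t1 t2 t3 t4 ap; split=> //.
- move=> x y; apply: (@truthful_merge (fun b d => k y b x d)) => z.
    exact: t2.
  exact: t4.
move=> w x y l e; rewrite /covers /= => /and4P[cw cx cy _].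
have := ap y w x w l e; rewrite /covers /= cw cx cy.
by move=> /(_ isT)/and5P[-> -> -> _ _].
Qed.

Lemma game4_merge14 : game3 rho (fun w x y => k w x y w).
Proof.
case: gk => r1 t1 t2 t3 t4 ap; split=> //.
- move=> x y; apply: (@truthful_merge (fun a d => k a x y d)) => z.
    exact: t1.
  exact: t4.
move=> w x y l e; rewrite /covers /= => /and4P[cw cx cy _].
have := ap w x y w l e; rewrite /covers /= cw cx cy.
by move=> /(_ isT)/and5P[-> -> -> _ _].
Qed.

Lemma game4_cost a b c d p q e v : 0 <= e ->
  (forall x, x \in [:: a; b; c; d] ->
    p - e <= x /\ x <= p + e \/ q - e <= x /\ x <= q + e) ->
  v \in [:: a; b; c; d] -> agent_cost (k a b c d) v <= rho * e.
Proof.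
move=> e0 pq; have /(game4_approx gk)/allP : covers (p, q) e [:: a; b; c; d].
  by apply/allP => x /pq[] [? ?]; rewrite cost_le /=; [left|right]; split; lra.
exact.
Qed.

(** Players 3 and 4 duel against the pair at [-1] and [0]; when they coincide they are one remote
    player, served by [remote_served]. *)
Lemma duel_game4 : duel rho 1 0 (8 * rho) (k (-1) 0).
Proof.
have r1 := game4_rho1 gk; split; try lra.
- by move=> y; exact: (game4_truthful3 gk).
- exact: (game4_truthful4 gk).
- by move=> z Mz; apply: (remote_served game4_merge34); lra.
move=> x y b Mx My xy yx.
apply: (game4_cost (p := 0) (q := x)); rewrite ?inE ?eqxx ?orbT //; first lra.
by move=> v; rewrite !inE => /or4P[] /eqP->; [left|left|right|right]; lra.
Qed.

Lemma inner_dominates : 32 * rho <= L ->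
  agent_cost (k (-1) 0 L (L + 1)) L < 1 ->
  exists u, [/\ L - 1 < u, u < L + 1 &
    forall c d, u <= c -> c <= d -> serves (k (-1) 0 c d) c].
Proof.
have r1 := game4_rho1 gk; move=> rL cL.
have [u [su u1 u2]] := cost_serves (lexx (agent_cost (k (-1) 0 L (L + 1)) L)).
exists u; split; try lra.
move=> c d; apply: (dominate duel_game4); first lra.
exists (L + 1); split; first lra.
  rewrite /close; have : rho * (L + 1 - u) <= rho * 2.
    by apply: ler_wpM2l; lra.
  lra.
exact: truthful_serves (game4_truthful3 gk _ _ _) su.
Qed.

End FourPlayers.

(** * Both inner players cannot be nearly served *)

Section Contradiction.
Variable R : realType.
Variables (rho L : R) (k : R -> R -> R -> R -> outcome R).
Hypothesis gk : game4 rho k.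

Lemma inner_locations_unserved : 32 * rho <= L ->
  agent_cost (k (-1) 0 L (L + 1)) 0 < 1 ->
  agent_cost (k (-1) 0 L (L + 1)) L < 1 -> False.
Proof.
have r1 := game4_rho1 gk; move=> rL c0 cL.
have [u [u1 u2 domC]] := inner_dominates gk rL cL.
have [p [p1 p2 domB]] : exists p, [/\ -1 < p, p < 1 &
    forall a, a <= p -> serves (k a p L (L + 1)) p].
  have cm : agent_cost (mirror L (k (L - (L + 1)) (L - L) (L - 0) (L - -1))) L
      < 1.
    rewrite cost_mirror subrr subr0 opprK.
    by have -> : L - (L + 1) = -1 by ring.
  have [u' [u1' u2' dom']] := inner_dominates (game4_mirror gk L) rL cm.
  exists (L - u'); split; [lra|lra|] => a ap.
  have := dom' u' (L - a) (lexx _); rewrite serves_mirror subr0 opprK.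
  have -> : L - (L - a) = a by ring.
  by apply; lra.
have u0 : 0 < u + 1 by lra.
(* Seen from [D], the points [-1] and [u] form a close pair. *)
pose D := u + 8 * (rho * (u + 1)) + 1.
have ru : 0 < rho * (u + 1) by apply: mulr_gt0; lra.
have uD : u < D by rewrite /D; lra.
have cuD : 8 * (rho * (u - -1)) <= D - u by rewrite /D; lra.
(* Seen from [- A], both pairs [p], [L] and [u], [D] are close. *)
pose A := 8 * (rho * (D + L + 1)) + 1.
have rA : rho * (D + L + 1) >= 1 * (D + L + 1) by apply: ler_wpM2r; lra.
have rDL (x : R) : x <= D + L + 1 -> rho * x <= rho * (D + L + 1).
  by move=> xD; apply: ler_wpM2l; lra.
have rDu := rDL (D - u) ltac:(lra).
have rLp := rDL (L - p) ltac:(lra).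
(* Player 2 goes from [0] to join player 4 at [D], leaving three locations. *)
have s1 : serves (k (-1) D u D) u.
  apply: (@irrelevant_move_left _ _ _ (fun b => k (-1) b u D) D u (-1) 0 D
    (game4_merge24 gk)) => //; try lra.
  - exact: (game4_truthful2 gk).
  - by apply: domC; lra.
  - have : agent_cost (k (-1) 0 u D) D <= rho * (u + 1).
      apply: (game4_cost gk (p := -1) (q := D));
        rewrite ?inE ?eqxx ?orbT //; first lra.
      by move=> v; rewrite !inE => /or4P[] /eqP->; [left|left|left|right]; lra.
    lra.
(* With players 2 and 4 merged at [D], the third player dominates leftwards, so the first may
   retreat to [- A]. *)
have s2 : serves (k (- A) D u D) u.
  by apply: (dominate3_left (game4_merge24 gk) uD _ cuD s1); rewrite /A; lra.
have s3 : serves (k (- A) D u (- A)) u.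
  apply: (@irrelevant_move _ _ _ (fun d => k (- A) D u d) (- A) u D D (- A)
    (game3_swap23 (game4_merge14 gk))) => //; try by rewrite /A; lra.
  - exact: (game4_truthful4 gk).
  - have : agent_cost (k (- A) D u D) (- A) <= rho * (D - u).
      apply: (game4_cost gk (p := - A) (q := u));
        rewrite ?inE ?eqxx ?orbT //; first lra.
      by move=> v; rewrite !inE => /or4P[] /eqP->; [left|right|right|right]; lra.
    by rewrite /A; lra.
have s4 : serves (k (- A) p L (- A)) p.
  apply: (@irrelevant_move _ _ _ (fun d => k (- A) p L d) (- A) p L (L + 1) (- A)
    (game4_merge14 gk)) => //; try by rewrite /A; lra.
  - exact: (game4_truthful4 gk).
  - by apply: domB; rewrite /A; lra.
  - have : agent_cost (k (- A) p L (L + 1)) (- A) <= rho * (L - p).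
      apply: (game4_cost gk (p := - A) (q := L));
        rewrite ?inE ?eqxx ?orbT //; first lra.
      by move=> v; rewrite !inE => /or4P[] /eqP->; [left|right|right|right]; lra.
    by rewrite /A; lra.
(* With players 1 and 4 merged at [- A], [s4] seeds player 2 and [s3] seeds player 3. *)
by apply: (no_min_rule3 (game4_merge14 gk) _ _ _ s4 _ uD _ s3); rewrite /A; lra.
Qed.

End Contradiction.

(** * Reducing [n] agents to four players *)

Section Groups.
Variables (R : realType) (n : nat).
Implicit Types (l : outcome R) (a b c d y e : R) (x : profile R n).

Lemma SC_ge0 l x : 0 <= SC l x.
Proof. by apply: sumr_ge0 => i _; exact: cost_ge0. Qed.

Lemma OPT_le_SC l x : OPT x <= SC l x.
Proof.
apply: ge_inf; last by exists l.
by exists 0 => _ [l' _ <-]; exact: SC_ge0.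
Qed.

Lemma OPT_ge0 x : 0 <= OPT x.
Proof.
apply: lb_le_inf; first by exists (SC (0, 0) x); exists (0, 0).
by move=> _ [l _ <-]; exact: SC_ge0.
Qed.

(** The deviating agents all stand at [y]; changing their reports one at a time never lowers the
    cost of [y]. *)
Lemma colocated_truthful (g : profile R n -> outcome R) x x' y :
  strategy_proof g -> (forall i, x i <> x' i -> x i = y) ->
  agent_cost (g x) y <= agent_cost (g x') y.
Proof.
move=> sp; suff gen (s : seq 'I_n) : forall x : profile R n,
    (forall i, x i <> x' i -> i \in s /\ x i = y) ->
    agent_cost (g x) y <= agent_cost (g x') y.
  move=> xy; apply: (gen (enum 'I_n)) => i xi.
  by rewrite mem_enum; split; last exact: xy.
elim: s => [|i s IHs] {}x xs.
  suff -> : x = x' by [].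
  by apply/funext => i; apply: contrapT => /xs[].
apply: (@le_trans _ _ (agent_cost (g (update x i (x' i))) y)).
  have [xi|/eqP xi] := eqVneq (x i) (x' i).
    suff -> : update x i (x' i) = x by [].
    by apply/funext => j; rewrite /update; case: eqP => // ->.
  have [_ <-] := xs i xi; exact: sp.
apply: IHs => j; rewrite /update; case: eqP => [-> //|ji /xs[]].
by rewrite inE => /orP[/eqP|].
Qed.

Variable m : nat.

Definition grouped a b c d : profile R n := fun i =>
  if i == 0%N :> nat then a else if i == 1%N :> nat then d
  else if (i < m.+2)%N then b else c.

Lemma SC_grouped l a b c d : (m.+2 <= n)%N ->
  SC l (grouped a b c d) = agent_cost l a + agent_cost l d +
    agent_cost l b *+ m + agent_cost l c *+ (n - m.+2).
Proof.
move=> mn; rewrite /SC /grouped.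
pose F (i : nat) := agent_cost l (if i == 0%N then a else if i == 1%N then d
  else if (i < m.+2)%N then b else c).
rewrite -(big_mkord xpredT F) (@big_cat_nat _ _ _ m.+2) //=.
rewrite (@big_cat_nat _ _ _ 2) //=; congr (_ + _ + _).
- by rewrite big_nat_recr //= big_nat1 /F.
- rewrite (eq_big_nat _ _ (F2 := fun=> agent_cost l b)).
    by rewrite sumr_const_nat subn2.
  by move=> [|[|i]] //= im; rewrite /F /= im.
- rewrite (eq_big_nat _ _ (F2 := fun=> agent_cost l c)).
    by rewrite sumr_const_nat.
  by move=> [|[|i]] //= /andP[im _]; rewrite /F /= ltnNge im.
Qed.

(** Social cost lies between the maximum cost and [n] times it, so a ratio in social cost costs only
    a factor [n] when read as a ratio in maximum cost. *)
Lemma game4_grouped (g : profile R n -> outcome R) lambda :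
  (0 < m)%N -> (m.+2 < n)%N -> strategy_proof g ->
  (forall x, SC (g x) x <= lambda * OPT x) ->
  game4 (Num.max lambda 1 * n%:R) (fun a b c d => g (grouped a b c d)).
Proof.
move=> m0 mn sp rob.
have l1 : 1 <= Num.max lambda 1 by rewrite le_max lexx orbT.
have ll : lambda <= Num.max lambda 1 by rewrite le_max lexx.
have n1 : 1 <= n%:R :> R by rewrite ler1n; lia.
split.
- exact: mulr_ege1.
- move=> b c d y y'; apply: (colocated_truthful sp) => i.
  by rewrite /grouped; do !case: ifP => _ //; case.
- move=> a c d y y'; apply: (colocated_truthful sp) => i.
  by rewrite /grouped; do !case: ifP => _ //; case.
- move=> a b d y y'; apply: (colocated_truthful sp) => i.
  by rewrite /grouped; do !case: ifP => _ //; case.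
- move=> a b c y y'; apply: (colocated_truthful sp) => i.
  by rewrite /grouped; do !case: ifP => _ //; case.
move=> a b c d l e /and5P[ca cb cc cd _].
set x := grouped a b c d.
have SCl : SC l x <= n%:R * e.
  rewrite mulr_natl -[X in _ *+ X]card_ord -sumr_const; apply: ler_sum => i _.
  by rewrite /x /grouped; repeat case: ifP => _.
have SCg : SC (g x) x <= Num.max lambda 1 * n%:R * e.
  apply: le_trans (rob x) _; rewrite -mulrA.
  apply: (@le_trans _ _ (Num.max lambda 1 * OPT x)).
    by apply: ler_wpM2r => //; exact: OPT_ge0.
  apply: ler_wpM2l; first by lra.
  by apply: le_trans SCl; exact: OPT_le_SC.
have := SC_grouped (g x) a b c d (ltnW mn); rewrite -/x => SCE.
have posM v (j : nat) : (0 < j)%N ->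
    agent_cost (g x) v <= agent_cost (g x) v *+ j.
  by case: j => // j _; rewrite mulrS lerDl mulrn_wge0 ?cost_ge0.
have nm0 : (0 < n - m.+2)%N by lia.
have := (cost_ge0 (g x) a, cost_ge0 (g x) b, cost_ge0 (g x) c,
  cost_ge0 (g x) d, posM b _ m0, posM c _ nm0).
move=> [[[[[a0 b0] c0] d0] bm] cm].
by rewrite /covers /=; apply/and5P; split; lra.
Qed.

End Groups.

Unset Implicit Arguments.

Theorem theorem2 (R : realType) :
  exists c : R, 0 < c /\
  exists N : nat, forall n : nat, (N <= n)%N ->
  forall f : mechanism R n,
    nice f -> bounded_robustness f ->
    consistency_at_least f (c * n%:R).
Proof.
exists (1 / 16); split; first by lra.
exists 4%N => n n4 f fnice [lambda rob] gamma cons.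
(* Both inner groups then have at least [m] agents, and [n <= 8 * m]; with [OPT x <= 2] this gives
   the constant [1 / 16]. *)
pose m := (n./2 - 1)%N.
have m0 : (0 < m)%N by rewrite /m; lia.
have mn : (m.+2 < n)%N by rewrite /m; lia.
have m8 : n%:R <= 8 * m%:R :> R by rewrite -natrM ler_nat /m; lia.
have mm : (m <= n - m.+2)%N by rewrite /m; lia.
have gk (xt : profile R n) := game4_grouped m0 mn (fnice xt).1 (rob xt).
set rho : R := Num.max lambda 1 * n%:R in gk.
pose L := 32 * rho.
pose x : profile R n := grouped m (-1) 0 L (L + 1).
have OPT2 : OPT x <= 2.
  apply: le_trans (OPT_le_SC (0, L) x) _; rewrite SC_grouped ?(ltnW mn) //.
  have z0 : agent_cost (0, L) 0 = 0.
    by apply/le_anti; rewrite cost_ge0 andbT cost_le /=; left; lra.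
  have zL : agent_cost (0, L) L = 0.
    by apply/le_anti; rewrite cost_ge0 andbT cost_le /=; right; lra.
  have a1 : agent_cost (0, L) (-1) <= 1 by rewrite cost_le /=; left; lra.
  have d1 : agent_cost (0, L) (L + 1) <= 1 by rewrite cost_le /=; right; lra.
  by rewrite z0 zL !mul0rn; lra.
have SCm : m%:R <= SC (f x x) x.
  rewrite leNgt; apply/negP => SCm.
  have SCE := SC_grouped (f x x) (-1) 0 L (L + 1) (ltnW mn).
  (* A group of at least [m] agents with total cost below [m] has individual cost below 1. *)
  have big_cost v (j : nat) : (m <= j)%N -> agent_cost (f x x) v *+ j <= SC (f x x) x ->
      agent_cost (f x x) v < 1.
    move=> mj vS; rewrite ltNge; apply/negP => v1.
    have : m%:R <= agent_cost (f x x) v *+ j.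
      apply: (@le_trans _ _ j%:R); first by rewrite ler_nat.
      by rewrite -[j%:R]/(1 *+ j) lerMn2r v1 orbT.
    lra.
  have posM v (j : nat) : 0 <= agent_cost (f x x) v *+ j.
    by rewrite mulrn_wge0 ?cost_ge0.
  have := (posM 0 m, posM L (n - m.+2)%N, cost_ge0 (f x x) (-1),
    cost_ge0 (f x x) (L + 1)).
  move=> [[[p0 pL] a0] d0].
  apply: (inner_locations_unserved (gk x) (lexx _)).
    by apply: (big_cost _ m) => //; rewrite SCE; lra.
  by apply: (big_cost _ _ mm); rewrite SCE; lra.
have cx := cons x; have O0 := OPT_ge0 x.
have m1 : 1 <= m%:R :> R by rewrite ler1n.
have [g0|g0] := leP 0 gamma.
  have : gamma * OPT x <= gamma * 2 by apply: ler_wpM2l.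
  lra.
have : gamma * OPT x <= 0 by apply: mulr_le0_ge0 => //; exact: ltW.
lra.
Qed.
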